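(* Let $E$ be an infinite-dimensional Banach space over $\mathbb{R}$ or $\mathbb{C}$. Then there exists a Borel probability measure $P$ on $E$ such that $P(V)=0$ for every finite-dimensional vector subspace $V$ of $E$.
   Context: A Borel probability measure on $E$ is a probability measure on the $\sigma$-algebra generated by the norm-open subsets of $E$. ''Annihilating'' a subspace means assigning it measure zero. *)

(* Defs.v *)
From HB Require Import structures.
From mathcomp Require Import all_boot all_order all_algebra.
From mathcomp Require Import all_classical all_reals all_analysis.
From mathcomp Require Import complex.

Set Implicit Arguments.
Unset Strict Implicit.
Unset Printing Implicit Defensive.

Import Order.TTheory GRing.Theory Num.Theory.
Import numFieldNormedType.Exports.

Local Open Scope classical_set_scope.
Local Open Scope ring_scope.

Definition lin_span (K : fieldType) (E : lmodType K) (n : nat)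
    (b : 'I_n -> E) : set E :=
  [set \sum_(i < n) a i *: b i | a in [set: 'I_n -> K]].

Definition finite_dimensional (K : fieldType) (E : lmodType K)
    (V : set E) : Prop :=
  exists (n : nat) (b : 'I_n -> E), V = lin_span b.

Definition borel_probability (R : realType) (E : ptopologicalType) : Type :=
  probability (g_sigma_algebraType (@open E)) R.

(* P is a total function on sets, as every measure of the library; this only
   mentions its values on finite-dimensional subspaces, which are closed in a
   normed space and hence Borel. *)
Definition annihilates_finite_dim (R : realType) (K : numFieldType)
    (E : normedModType K) (P : borel_probability R E) : Prop :=
  forall V : set E, submod_closed (mem V) -> finite_dimensional V ->
    (P : set E -> \bar R) V = 0%E.

(* Main.v *)
Require Import Defs.
From HB Require Import structures.
From mathcomp Require Import all_boot all_order all_algebra finmap.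
From mathcomp Require Import all_classical all_reals all_analysis.
From mathcomp Require Import complex ring lra.

(** E contains a continuous curve f : R -> E such that the points at any finitely
many distinct parameters are linearly independent. An n-dimensional subspace V
then contains at most n points of the curve, so the preimage of V under f is
finite, and the image under f of the uniform probability on [0, 1] gives V
measure 0.

The curve is a moment curve f(t) = \sum_k t ^ k *: x k. A relation
\sum_j c j *: f (t j) = 0 becomes \sum_k a k *: x k = 0 where a k is the moment
\sum_j c j * t j ^ k. For |t j| <= 1 the moments are bounded; so if the x k
satisfy no nontrivial infinite relation with bounded coefficients
([bounded_independent]), all moments vanish, and so does c by Vandermonde
([moments_eq0], [moment_curve_free]).

Such x k are obtained without the Hahn-Banach theorem ([rapid_sequence]). Pick
vectors e k, each outside the span of the previous ones. On the span of the
first n of them the coordinate functionals are bounded by some C n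
([coord_bounds]); by induction on n this amounts to the closedness of these
spans, which follows from the completeness of the scalar field ([span_gap]).
Then x k = s k *: e k, with s k so small that the tail of any bounded
combination, multiplied by C n, is at most of order 1 / 2 ^ n; a vanishing
combination has each of its coefficients bounded by all these tails.

The argument is carried out once, over a field K that contains R and whose
absolute values are real, and applied to K = R and K = R[i]. All convergence in
K is expressed by geometric estimates of the form c / 2 ^ n. *)

Set Implicit Arguments.
Unset Strict Implicit.
Unset Printing Implicit Defensive.

Import Order.TTheory GRing.Theory Num.Theory.
Import numFieldNormedType.Exports.

Local Open Scope classical_set_scope.
Local Open Scope ring_scope.

(** * Scalars with real absolute values *)

(** What the real and the complex field have in common: an embedding of the
reals for which every absolute value is real. It makes one proof serve both
fields, and it transfers the archimedean property of the reals to K, although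
K is only partially ordered. *)
Record real_normed (R : realType) (K : numFieldType)
    (iota : {rmorphism R -> K}) : Prop := RealNormed {
  norm_iota : forall r, `|iota r| = iota `|r|;
  norm_in_iota : forall a : K, exists r, `|a| = iota r
}.

(** Completeness of the scalar field, in the only form that is needed. Over the
complex numbers the real and imaginary parts each contribute an error of 2,
whence the factor 4. *)
Definition geometrically_complete (K : numFieldType) :=
  forall (u : nat -> K) (c : K), (forall n, `|u n.+1 - u n| <= c / 2 ^+ n) ->
  exists l, forall n, `|l - u n| <= 4 * c / 2 ^+ n.

(** Summing the geometric series of the increments; in particular partial sums
whose terms decay like 1 / 2 ^ k never leave a ball around the first one. *)
Lemma geometric_dist (K : numFieldType) (V : normedZmodType K)
    (u : nat -> V) (c : K) : (forall n, `|u n.+1 - u n| <= c / 2 ^+ n) ->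
  forall n m, `|u (n + m)%N - u n| <= 2 * c / 2 ^+ n.
Proof.
move=> uc n m.
have c0 : 0 <= c.
  by have := uc 0; rewrite expr0 divr1; apply: le_trans.
have p0 k : (0 : K) <= (2 ^+ k)^-1 by rewrite invr_ge0 exprn_ge0.
(* The sharp bound, with the tail of the series kept, is what induction on m
   preserves. *)
suff : `|u (n + m)%N - u n| <= 2 * c / 2 ^+ n - 2 * c / 2 ^+ (n + m).
  move/le_trans; apply; rewrite gerBl mulr_ge0 ?mulr_ge0 //.
elim: m => [|m IH]; first by rewrite addn0 !subrr normr0.
rewrite addnS -(subrKA (u (n + m)%N)).
apply: (le_trans (ler_normD _ _)).
apply: (le_trans (lerD (uc _) IH)).
rewrite le_eqVlt; apply/orP; left; apply/eqP.
rewrite [(2 ^+ (n + m).+1)]exprS.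
have p : (2 ^+ (n + m) : K) != 0 by rewrite expf_neq0.
have q : (2 ^+ n : K) != 0 by rewrite expf_neq0.
by field; rewrite p q.
Qed.

Section Scalars.
Context (R : realType) (K : numFieldType) (iota : {rmorphism R -> K}).
Hypothesis iotaN : real_normed iota.

Lemma iota_ge0 r : 0 <= r -> 0 <= iota r.
Proof. by move=> /ger0_norm <-; rewrite -(norm_iota iotaN). Qed.

Lemma iota_gt0 r : 0 < r -> 0 < iota r.
Proof. by move=> r0; rewrite lt0r iota_ge0 ?ltW// fmorph_eq0 gt_eqF. Qed.

Lemma iota_lt r s : r < s -> iota r < iota s.
Proof. by move=> rs; rewrite -subr_gt0 -rmorphB iota_gt0// subr_gt0. Qed.

Lemma iota_le r s : r <= s -> iota r <= iota s.
Proof. by move=> rs; rewrite -subr_ge0 -rmorphB iota_ge0// subr_ge0. Qed.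

Lemma pos_in_iota (e : K) : 0 < e -> exists2 r, 0 < r & e = iota r.
Proof.
move=> e0; have [r er] := norm_in_iota iotaN e; rewrite gtr0_norm// in er.
exists r => //; rewrite ltNge; apply/negP => r0; move: e0.
by rewrite er -(opprK r) rmorphN oppr_gt0 le_gtF ?iota_ge0 ?oppr_ge0.
Qed.

(** The archimedean property of R, carried to K through iota. *)
Lemma exists_halving (c e : K) : 0 <= c -> 0 < e ->
  exists n, c / 2 ^+ n < e.
Proof.
move=> c0 e0.
have c1 : 0 < c + 1 by rewrite ltr_wpDl.
have [r r0 er] := pos_in_iota (divr_gt0 e0 c1).
have [n rn] : exists n, r^-1 < n%:R.
  by exists (Num.bound r^-1); apply: archi_boundP; rewrite invr_ge0 ltW.
exists n.
have p0 : 0 < (2 ^+ n : K) by rewrite exprn_gt0.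
rewrite ltr_pdivrMr// (le_lt_trans (_ : c <= c + 1)) ?lerDl//.
rewrite mulrC -ltr_pdivrMr// -[_ / _]invf_div er -fmorphV.
have -> : 2 ^+ n = iota (2 ^+ n) by rewrite rmorphXn rmorph_nat.
apply/iota_lt/(lt_trans rn); rewrite -natrX ltr_nat.
exact: ltn_expl.
Qed.

(** Stands for passing to the limit in an inequality; nonnegativity of x and y
makes them comparable in the partial order of K. *)
Lemma le_of_geometric (x y c : K) : 0 <= x -> 0 <= y ->
  (forall n, x <= y + c / 2 ^+ n) -> x <= y.
Proof.
move=> x0 y0 H.
have xr : x \is Num.real by exact: ger0_real.
have yr : y \is Num.real by exact: ger0_real.
rewrite real_leNgt//; apply/negP => yx.
have xy0 : 0 < x - y by rewrite subr_gt0.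
have H' n : x - y <= c / 2 ^+ n by rewrite lerBlDl.
have c0 : 0 <= c by have := H' 0; rewrite expr0 divr1; exact/le_trans/ltW.
have [n] := exists_halving c0 xy0.
by move=> /(le_lt_trans (H' n)); rewrite ltxx.
Qed.

Lemma eq0_of_geometric (V : normedZmodType K) (x : V) (c : K) :
  (forall n, `|x| <= c / 2 ^+ n) -> x = 0.
Proof.
move=> H; apply/normr0_eq0/le_anti/andP; split => //.
by apply: (@le_of_geometric _ _ c) => // n; rewrite add0r.
Qed.

Lemma geometric_limit (E : completeNormedModType K) (u : nat -> E) (c : K) :
  (forall n, `|u n.+1 - u n| <= c / 2 ^+ n) ->
  exists l, forall n, `|l - u n| <= 2 * c / 2 ^+ n.
Proof.
move=> uc.
have c0 : 0 <= c.
  by have := uc 0; rewrite expr0 divr1; apply: le_trans.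
have /cauchy_cvg/cvg_ex[l ul] : cauchy (u @ \oo).
  apply/cauchy_exP => e e0.
  have [n ne] := exists_halving (mulr_ge0 (ler0n _ 2) c0) e0.
  exists (u n); exists n => // m /= /subnKC <-.
  rewrite -ball_normE /= distrC.
  exact: le_lt_trans (geometric_dist uc _ _) ne.
exists l => n.
have p0 : 0 <= ((2 ^+ n)^-1 : K) by rewrite invr_ge0 exprn_ge0.
apply: (@le_of_geometric _ _ 1) => [//||k]; first by rewrite !mulr_ge0.
have k0 : 0 < (1 / 2 ^+ k : K) by rewrite divr_gt0// exprn_gt0.
have /cvgrPdist_lt/(_ _ k0)[N _ HN] := ul.
rewrite -(subrKA (u (n + N)%N)) addrC.
apply: (le_trans (ler_normD _ _)); apply: lerD (geometric_dist uc _ _) _.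
by apply/ltW/HN; rewrite /= leq_addl.
Qed.

End Scalars.

(** * Coordinates on spans of independent vectors *)

Section Sequences.
Context (R : realType) (K : numFieldType) (iota : {rmorphism R -> K}).
Hypotheses (iotaN : real_normed iota) (Kcomplete : geometrically_complete K).
Context (E : normedModType K).

(** Boundedness of the coordinate functionals on the span of the first n vectors:
a quantitative linear independence, which replaces the equivalence of norms in
finite dimension and needs no compactness of the scalars. *)
Definition coord_bounded (e : nat -> E) (n : nat) (C : K) :=
  forall (a : nat -> K) (i : nat), (i < n)%N ->
    `|a i| <= C * `|\sum_(j < n) a j *: e j|.

(** The span of finitely many vectors with bounded coordinates is closed: if
combinations approach y geometrically, then their coordinates converge in K,
and the combination of the limits equals y. *)
Lemma span_gap (e : nat -> E) n C (y : E) : 0 <= C -> coord_bounded e n C ->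
  (forall a : nat -> K, y <> \sum_(j < n) a j *: e j) ->
  exists2 d : K, 0 < d &
    forall a : nat -> K, d <= `|y - \sum_(j < n) a j *: e j|.
Proof.
move=> C0 eC yS; apply: contrapT => nd.
have p0 k : 0 < ((2 ^+ k)^-1 : K) by rewrite invr_gt0 exprn_gt0.
have /choice[a ya] : forall k, exists a : nat -> K,
    `|y - \sum_(j < n) a j *: e j| <= 1 / 2 ^+ k.
  move=> k; apply: contrapT => na; apply: nd; exists (1 / 2 ^+ k) => [|a].
    by rewrite div1r p0.
  have rk : (1 / 2 ^+ k : K) \is Num.real by rewrite ger0_real// div1r ltW.
  have [//|/ltW le] := real_leP rk (normr_real (y - \sum_(j < n) a j *: e j)).
  by exfalso; apply: na; exists a.
have sumB (b b' : nat -> K) : \sum_(j < n) (b j - b' j) *: e j =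
    \sum_(j < n) b j *: e j - \sum_(j < n) b' j *: e j.
  by rewrite -sumrB; apply: eq_bigr => j _; rewrite scalerBl.
have /choice[l al] : forall i, exists l, (i < n)%N ->
    forall k, `|l - a k i| <= 4 * (C * 2) / 2 ^+ k.
  move=> i; have [ni|] := ltnP i n; last by exists 0.
  have /Kcomplete[l] : forall k,
      `|a k.+1 i - a k i| <= C * 2 / 2 ^+ k.
    move=> k; apply: (le_trans (eC (fun j => a k.+1 j - a k j) i ni)).
    rewrite -mulrA ler_wpM2l// sumB -(subrKA y).
    apply: (le_trans (ler_normD _ _)).
    rewrite mulrDl; apply: lerD (ya _); rewrite distrC.
    apply: (le_trans (ya _)); rewrite !div1r lef_pV2 ?posrE ?exprn_gt0//.
    by rewrite exprS ler_peMl ?exprn_ge0// ler1n.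
  by exists l.
apply: (yS l); apply/eqP; rewrite -subr_eq0; apply/eqP.
apply: (@eq0_of_geometric _ _ _ iotaN _ _
  (1 + \sum_(j < n) (4 * (C * 2)) * `|e j|)) => k.
rewrite -(subrKA (\sum_(j < n) a k j *: e j)).
apply: (le_trans (ler_normD _ _)); rewrite mulrDl.
apply: (lerD (ya k)); rewrite distrC -sumB mulr_suml.
apply: (le_trans (ler_norm_sum _ _ _)); apply: ler_sum => j _.
by rewrite normrZ mulrAC ler_wpM2r// al.
Qed.

(** The gap d between e n and the earlier vectors bounds the last coordinate:
after division by a n, the combination is e n minus a vector of their span.
Subtracting a n *: e n leaves a combination to which C applies. *)
Lemma coord_boundedS (e : nat -> E) n C : 0 <= C -> coord_bounded e n C ->
  (forall a : nat -> K, e n <> \sum_(j < n) a j *: e j) ->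
  exists2 C', 0 <= C' & coord_bounded e n.+1 C'.
Proof.
move=> C0 eC en; have [d d0 dS] := span_gap C0 eC en.
have d1 : 0 <= d^-1 by rewrite invr_ge0 ltW.
exists (d^-1 + (C + C * (d^-1 * `|e n|))).
  by rewrite !addr_ge0// !mulr_ge0.
move=> a i; set S := \sum_(j < n.+1) a j *: e j.
have an : `|a n| <= d^-1 * `|S|.
  have [->|an0] := eqVneq (a n) 0; first by rewrite normr0 mulr_ge0.
  rewrite mulrC ler_pdivlMr//.
  have := dS (fun j => - ((a n)^-1 * a j)).
  move/(ler_wpM2l (normr_ge0 (a n))); rewrite -normrZ.
  congr (_ <= `|_|); rewrite scalerBr scaler_sumr /S big_ord_recr/= addrC.
  congr (_ + _); rewrite -sumrN; apply: eq_bigr => j _.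
  by rewrite scaleNr scalerN opprK scalerA mulrA mulfV// mul1r.
rewrite ltnS leq_eqVlt => /orP[/eqP->|ni].
  apply: (le_trans an); rewrite ler_wpM2r// lerDl.
  by rewrite !addr_ge0// !mulr_ge0.
apply: (le_trans (eC a i ni)).
apply: (@le_trans _ _ ((C + C * (d^-1 * `|e n|)) * `|S|)); last first.
  by rewrite ler_wpM2r// lerDr.
rewrite mulrDl -mulrA -mulrDr ler_wpM2l//.
have -> : \sum_(j < n) a j *: e j = S - a n *: e n.
  by rewrite /S big_ord_recr/= addrK.
apply: (le_trans (ler_normB _ _)); rewrite lerD2l normrZ mulrAC.
by rewrite ler_wpM2r.
Qed.

Lemma coord_bounds (e : nat -> E) :
  (forall n (a : nat -> K), e n <> \sum_(j < n) a j *: e j) ->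
  exists C : nat -> K, forall n, 0 <= C n /\ coord_bounded e n (C n).
Proof.
move=> en.
have /choice[C CP] : forall n, exists C, 0 <= C /\ coord_bounded e n C.
  elim=> [|n [C [C0 eC]]]; first by exists 0.
  by have [C' ? ?] := coord_boundedS C0 eC (en n); exists C'.
by exists C.
Qed.

Lemma independent_sequence : ~ finite_dimensional [set: E] ->
  exists e : nat -> E,
    forall n (a : nat -> K), e n <> \sum_(j < n) a j *: e j.
Proof.
move=> infE.
have /choice[pick pickP] : forall s : seq E, exists y,
    forall a : nat -> K, y <> \sum_(j < size s) a j *: s`_j.
  move=> s; apply: contrapT => ns; apply: infE.
  exists (size s), (fun i => s`_i); apply/seteqP; split => // y _.
  apply: contrapT => ny; apply: ns; exists y => a ya; apply: ny.
  by exists (fun i => a i).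
pose s n := iter n (fun s => rcons s (pick s)) [::].
pose e n := pick (s n); exists e => n a.
have sE : s n = mkseq e n.
  by elim: n => //= n; rewrite /mkseq -addn1 iotaD map_cat cats1 /= => <-.
have -> : e n = pick (mkseq e n) by rewrite -sE.
have := pickP (mkseq e n) a; rewrite size_mkseq.
congr (_ <> _); apply: eq_bigr => j _.
by rewrite nth_mkseq.
Qed.
End Sequences.

(** * Rapidly decreasing independent sequences *)

Section Rapid.
Context (R : realType) (K : numFieldType) (iota : {rmorphism R -> K}).
Hypothesis iotaN : real_normed iota.
Context (E : normedModType K).

(** Linear independence strengthened to infinite combinations with bounded
coefficients. Convergence of the series to 0 is asked at a geometric rate,
which is how it will occur. *)
Definition bounded_independent (x : nat -> E) :=
  forall (a : nat -> K) (A B : K), (forall k, `|a k| <= A) ->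
    (forall n, `|\sum_(j < n) a j *: x j| <= B / 2 ^+ n) ->
    forall m, a m = 0.

(** If the full series vanishes, its n-th partial sum equals minus its tail. The
tail is so small that, even after multiplication by the coordinate bound C of
the first n vectors, it is at most 2 * A / 2 ^ n; this bounds the fixed
quantity a m * s for all n, hence a m = 0. *)
Lemma rapid_bounded_independent (x : nat -> E) :
  (forall m, exists2 s : K, 0 < s & forall n, (m < n)%N ->
    exists C : K, [/\ 0 <= C,
      forall a : nat -> K, `|a m| * s <= C * `|\sum_(j < n) a j *: x j| &
      forall k, (n <= k)%N -> C * `|x k| <= 1 / 2 ^+ k]) ->
  bounded_independent x.
Proof.
move=> xP a A B aA aB m; have [s s0 xs] := xP m.
have A0 : 0 <= A by apply: le_trans (aA 0).
have B0 : 0 <= B by have := aB 0; rewrite expr0 divr1; apply: le_trans.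
have p0 k : 0 <= ((2 ^+ k)^-1 : K) by rewrite invr_ge0 exprn_ge0.
have pD k l : ((2 ^+ (k + l))^-1 : K) <= (2 ^+ l)^-1.
  rewrite lef_pV2 ?posrE ?exprn_gt0// exprD.
  by rewrite ler_peMl ?exprn_ge0 ?exprn_ege1// ler1n.
suff tail n : (m < n)%N -> `|a m| * s <= 2 * A / 2 ^+ n.
  have : a m * s = 0.
    apply: (@eq0_of_geometric _ _ _ iotaN K _ (2 * A)) => n.
    rewrite normrM (gtr0_norm s0); apply: (le_trans (tail (m.+1 + n)%N _)).
      by rewrite addSn ltnS leq_addr.
    by rewrite ler_wpM2l ?mulr_ge0.
  by move/eqP; rewrite mulf_eq0 (gt_eqF s0) orbF => /eqP.
move=> mn; have [C [C0 aC xC]] := xs n mn.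
apply: (@le_of_geometric _ _ _ iotaN _ _ (C * B)) => [||N].
- by rewrite mulr_ge0// ltW.
- by rewrite !mulr_ge0.
apply: (le_trans (aC a)).
pose S k := \sum_(j < k) a j *: x j.
(* u records the partial sums beyond n, scaled by C; its increments are at
   most (A / 2 ^ n) / 2 ^ k. *)
pose u k := C *: S (n + k)%N.
have := @geometric_dist K E u (A / 2 ^+ n) _ 0 N.
rewrite add0n expr0 divr1 => uN.
have -> : C * `|\sum_(j < n) a j *: x j| = `|u 0|.
  by rewrite /u addn0 normrZ ger0_norm.
rewrite -[X in `|X|](subrK (u N)).
apply: (le_trans (ler_normD _ _)); apply: lerD.
  rewrite distrC mulrA in uN *; apply: uN => k.
  rewrite /u -scalerBr /S addnS big_ord_recr/= addrAC subrr add0r.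
  rewrite !normrZ ger0_norm// mulrCA -mulrA.
  apply: ler_pM; rewrite ?mulr_ge0//.
  by rewrite -invfM -exprD -div1r xC// leq_addr.
rewrite normrZ (ger0_norm C0) -mulrA ler_wpM2l//.
by apply: (le_trans (aB _)); rewrite ler_wpM2l.
Qed.

(** The vectors are independent vectors e k rescaled after the fact: s k may be
chosen as small as the coordinate bounds C 0, ..., C k require. The factor
k + 1 is there to make the moment curve below Lipschitz. *)
Lemma rapid_sequence : geometrically_complete K ->
  ~ finite_dimensional [set: E] ->
  exists2 x : nat -> E, forall k, k.+1%:R * `|x k| <= 1 / 2 ^+ k &
    bounded_independent x.
Proof.
move=> Kcomplete /independent_sequence[e eI].
have [C CP] := coord_bounds iotaN Kcomplete eI.
(* D k dominates both k + 1 and C n for every n <= k. *)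
pose D k := k.+1%:R + \sum_(i < k.+1) C i.
have sC k : 0 <= \sum_(i < k.+1) C i by apply: sumr_ge0 => i _; case: (CP i).
have Dk k : k.+1%:R <= D k by rewrite lerDl.
have D0 k : 0 < D k by apply: lt_le_trans (Dk k); rewrite ltr0n.
have DC n k : (n <= k)%N -> C n <= D k.
  rewrite -ltnS => nk; rewrite /D (bigD1 (Ordinal nk))//= addrCA lerDl.
  by rewrite addr_ge0 ?sumr_ge0// => i _; case: (CP i).
have e0 k : 0 < 1 + `|e k| by rewrite ltr_pwDl.
pose s k := (2 ^+ k * D k * (1 + `|e k|))^-1.
have s0 k : 0 < s k by rewrite invr_gt0 !mulr_gt0// exprn_gt0.
pose x k := s k *: e k.
have xD k c : 0 <= c -> c <= D k -> c * `|x k| <= 1 / 2 ^+ k.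
  move=> c0 cD; rewrite normrZ gtr0_norm//.
  apply: (@le_trans _ _ (D k * (s k * (1 + `|e k|)))).
    by rewrite ler_pM ?mulr_ge0 ?(ltW (s0 k))// ler_pM2l// lerDr.
  rewrite /s le_eqVlt; apply/orP; left; apply/eqP; field.
  by rewrite expf_neq0// !gt_eqF.
exists x => [k|]; first exact: xD.
apply: rapid_bounded_independent => m; exists (s m) => // n mn.
have [C0 eC] := CP n; exists (C n); split => // [a|k nk]; last exact/xD/DC.
have := eC (fun j => a j * s j) m mn; rewrite normrM (gtr0_norm (s0 m)).
by under eq_bigr do rewrite -scalerA.
Qed.
End Rapid.

(** * The moment curve *)

(** Invertibility of the Vandermonde matrix: evaluate at the Lagrange polynomial
that vanishes at all nodes but one. *)
Lemma moments_eq0 (K : fieldType) n (t c : 'I_n -> K) : injective t ->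
  (forall k, \sum_(j < n) c j * t j ^+ k = 0) -> forall j, c j = 0.
Proof.
move=> tI ct j.
have cp (p : {poly K}) : \sum_(i < n) c i * p.[t i] = 0.
  under eq_bigr do rewrite horner_coef mulr_sumr.
  rewrite exchange_big big1// => k _.
  under eq_bigr do rewrite mulrCA.
  by rewrite -mulr_sumr ct mulr0.
have := cp (\prod_(i < n | i != j) ('X - (t i)%:P)).
rewrite (bigD1 j)//= [X in _ + X]big1 => [|i ij]; last first.
  by rewrite (bigD1 i)//= hornerM hornerXsubC subrr mul0r mulr0.
rewrite addr0 => /eqP; rewrite mulf_eq0 => /orP[/eqP//|].
rewrite horner_prod => /prodf_eq0[i ij].
by rewrite hornerXsubC subr_eq0 (inj_eq tI) eq_sym (negPf ij).
Qed.

Lemma dist_expr (K : numFieldType) (s t : K) n : `|s| <= 1 -> `|t| <= 1 ->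
  `|s ^+ n - t ^+ n| <= n%:R * `|s - t|.
Proof.
move=> s1 t1; elim: n => [|n IH]; first by rewrite subrr normr0 mul0r.
have -> : s ^+ n.+1 - t ^+ n.+1 = (s - t) * t ^+ n + s * (s ^+ n - t ^+ n).
  by rewrite !exprS; ring.
apply: (le_trans (ler_normD _ _)).
have -> : n.+1%:R = 1 + n%:R :> K by rewrite nat1r.
rewrite [leRHS]mulrDl mul1r !normrM normrX.
apply: lerD; first by rewrite ler_piMr// exprn_ile1.
by apply: le_trans IH; rewrite ler_piMl.
Qed.

Section MomentCurve.
Context (R : realType) (K : numFieldType) (iota : {rmorphism R -> K}).
Hypothesis iotaN : real_normed iota.
Context (E : completeNormedModType K) (x : nat -> E).
Hypothesis x_decay : forall k, k.+1%:R * `|x k| <= 1 / 2 ^+ k.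
Hypothesis x_indep : bounded_independent x.

(** On the closed unit disc, f is the sum of the power series with coefficients
x, with the rate of convergence made explicit. *)
Definition moment_curve (f : K -> E) := forall t, `|t| <= 1 ->
  forall n, `|f t - \sum_(j < n) t ^+ j *: x j| <= 2 / 2 ^+ n.

Lemma moment_curve_exists : exists f, moment_curve f.
Proof.
have /choice[f fP] : forall t, exists l : E, `|t| <= 1 -> forall n,
    `|l - \sum_(j < n) t ^+ j *: x j| <= 2 / 2 ^+ n.
  move=> t; have [t1|] := boolP (`|t| <= 1); last by exists 0.
  have [n|l lP] := @geometric_limit _ _ _ iotaN E
      (fun n => \sum_(j < n) t ^+ j *: x j) 1; last first.
    by exists l => _ n; have := lP n; rewrite mulr1.
  rewrite big_ord_recr/= addrAC subrr add0r normrZ.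
  apply: le_trans (x_decay n); rewrite ler_wpM2r//.
  by rewrite normrX (@le_trans _ _ 1) ?exprn_ile1// ler1n.
by exists f.
Qed.

Variable f : K -> E.
Hypothesis fP : moment_curve f.

(** The increment of t ^ k is at most k times that of t, and k * |x k| is
geometrically small. *)
Lemma moment_curve_lipschitz s t : `|s| <= 1 -> `|t| <= 1 ->
  `|f s - f t| <= 2 * `|s - t|.
Proof.
move=> s1 t1.
pose u n := \sum_(j < n) s ^+ j *: x j - \sum_(j < n) t ^+ j *: x j.
have uL n : `|u n| <= 2 * `|s - t|.
  have := @geometric_dist K E u `|s - t| _ 0 n.
  have u0 : u 0 = 0 by rewrite /u !big_ord0 subrr.
  rewrite add0n expr0 divr1 u0 subr0; apply => k.
  have -> : u k.+1 = u k + (s ^+ k - t ^+ k) *: x k.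
    by rewrite /u !big_ord_recr/= scalerBl opprD addrACA.
  rewrite [u k + _]addrC addrK.
  rewrite normrZ; apply: (@le_trans _ _ (k%:R * `|s - t| * `|x k|)).
    by rewrite ler_wpM2r// dist_expr.
  rewrite mulrAC mulrC ler_wpM2l// -div1r.
  by apply: le_trans (x_decay k); rewrite ler_wpM2r// ler_nat.
apply: (@le_of_geometric _ _ _ iotaN _ _ 4) => [//||n].
  by rewrite mulr_ge0.
have -> : f s - f t = u n + ((f s - \sum_(j < n) s ^+ j *: x j) -
    (f t - \sum_(j < n) t ^+ j *: x j)).
  rewrite /u; set a := \sum_(j < n) _; set b := \sum_(j < n) _.
  rewrite [RHS]addrC [- (f t - b)]opprB [RHS]addrACA subrK.
  by rewrite [b - _ - b]addrAC subrr add0r.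
apply: (le_trans (ler_normD _ _)); apply: lerD (uL n) _.
apply: (le_trans (ler_normB _ _)).
by apply: (le_trans (lerD (fP s1 n) (fP t1 n))); rewrite -mulrDl -natrD.
Qed.

(** A relation between points of the curve is a relation between the vectors x
k, whose coefficients are the moments \sum_j c j * t j ^ k. These are
bounded, hence all vanish. *)
Lemma moment_curve_free n (t c : 'I_n -> K) : injective t ->
  (forall j, `|t j| <= 1) -> \sum_(j < n) c j *: f (t j) = 0 ->
  forall j, c j = 0.
Proof.
move=> tI t1 cf; apply: (moments_eq0 tI).
apply: (x_indep (A := \sum_(j < n) `|c j|)
    (B := \sum_(j < n) `|c j| * 2)) => [k|m].
  apply: (le_trans (ler_norm_sum _ _ _)); apply: ler_sum => j _.
  by rewrite normrM normrX ler_piMr// exprn_ile1.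
under eq_bigr do rewrite scaler_suml.
rewrite exchange_big/=.
under eq_bigr do under eq_bigr do rewrite -scalerA.
under eq_bigr do rewrite -scaler_sumr.
rewrite -[X in `|X|]subr0 -[X in _ - X]cf -sumrB mulr_suml.
apply: (le_trans (ler_norm_sum _ _ _)); apply: ler_sum => j _.
by rewrite -scalerBr normrZ distrC -mulrA ler_wpM2l// fP.
Qed.

(** In a subspace spanned by n vectors, n + 1 points of the curve would be
linearly dependent. *)
Lemma moment_curve_finite (T : choiceType) (g : T -> K) (V : set E) :
  injective g -> (forall r, `|g r| <= 1) -> finite_dimensional V ->
  finite_set ((f \o g) @^-1` V).
Proof.
move=> gI g1 [n [b ->]]; apply: contrapT.
move=> /(@infinite_set_fset _ _ n.+1)[B BV Bn].
have Bj (j : 'I_n.+1) : (j < size (enum_fset B))%N by apply: leq_trans Bn.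
have B0 : T by case: (enum_fset B) (Bj ord0) => // r.
pose r (j : 'I_n.+1) := nth B0 (enum_fset B) j.
have rI : injective r.
  move=> i j /eqP; rewrite nth_uniq ?fset_uniq// => /eqP; exact: val_inj.
have /choice[M MP] : forall j, exists a : 'I_n -> K,
    f (g (r j)) = \sum_(i < n) a i *: b i.
  move=> j; have /BV[a _ aE] : [set` B] (r j) by apply: mem_nth.
  by exists a.
pose A := \matrix_(j < n.+1, i < n) M j i.
(* Row j of A holds coordinates of the j-th point with respect to b; A has more
   rows than columns, so its rows satisfy a nontrivial relation c. *)
have : kermx A != 0.
  by rewrite -mxrank_eq0 mxrank_ker subn_eq0 -ltnNge ltnS rank_leq_col.
case/rowV0Pn => c /sub_kermxP cA /eqP; apply.
apply/rowP => j; rewrite mxE.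
apply: (@moment_curve_free _ (g \o r) (fun j => c 0 j)) => [|i|].
- exact: inj_comp.
- exact: g1.
under eq_bigr do rewrite /= MP scaler_sumr.
rewrite exchange_big big1//= => i _.
under eq_bigr do rewrite scalerA.
rewrite -scaler_suml; have /matrixP/(_ 0 i) := cA.
rewrite !mxE; under eq_bigr do rewrite mxE.
by move=> ->; rewrite scale0r.
Qed.
End MomentCurve.

(** * Transporting Lebesgue measure *)

(** The image under f of the uniform probability on [0, 1] works, because finite
sets of reals are Lebesgue null. *)
Lemma pushforward_annihilates (R : realType) (K : numFieldType)
    (E : normedModType K) (f : R -> E) : continuous f ->
  (forall V : set E, finite_dimensional V -> finite_set (f @^-1` V)) ->
  exists P : borel_probability R E, annihilates_finite_dim P.
Proof.
move=> /continuousP cf fV.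
pose g : measurableTypeR R -> g_sigma_algebraType (@open E) := f.
have mg : measurable_fun setT g.
  pose G : set (set (g_sigma_algebraType (@open E))) := @open E.
  refine (measurability G _ _) => //.
  move=> _ [U oU <-].
  by rewrite setTI; apply: measurable_realfun.open_measurable; exact: cf.
pose G : {mfun measurableTypeR R >-> g_sigma_algebraType (@open E)} :=
  HB.pack g (isMeasurableFun.Build _ _ _ _ g mg).
exists (distribution (uniform_prob (@ltr01 R)) G) => V _ /fV fin.
have /null_content_dominatesP := dominates_uniform_prob (@ltr01 R).
apply; last exact/countable_lebesgue_measure0/finite_set_countable.
by apply: countable_measurable => //; exact: finite_set_countable.
Qed.

(** The moment curve lives over the unit disc; r |-> atan r / 2 reparametrises
it injectively and continuously by the whole real line. *)
Theorem annihilating_probability (R : realType) (K : numFieldType)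
    (iota : {rmorphism R -> K}) (E : completeNormedModType K) :
  real_normed iota -> geometrically_complete K ->
  ~ finite_dimensional [set: E] ->
  exists P : borel_probability R E, annihilates_finite_dim P.
Proof.
move=> iotaN Kcomplete /(rapid_sequence iotaN Kcomplete)[x x_decay x_indep].
have [f fP] := moment_curve_exists iotaN x_decay.
pose g (r : R) := iota (atan r / 2).
have g1 r : `|g r| <= 1.
  rewrite (norm_iota iotaN) -(rmorph1 iota) (iota_le iotaN)//.
  have := pihalf_lt2 R; have := atan_gtNpi2 r; have := atan_ltpi2 r.
  by rewrite ler_norml; lra.
have gI : injective g.
  move=> r s /fmorph_inj/(mulIf _) rs.
  by apply: (can_inj (@atanK R)); apply: rs; rewrite invr_eq0.
apply: (@pushforward_annihilates _ _ _ (f \o g)) => [r|V finV]; last first.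
  exact: (moment_curve_finite x_indep fP).
apply/cvgrPdist_lt => e e0.
have [d d0 ed] := pos_in_iota iotaN (divr_gt0 e0 (ltr0n K 2)).
have /cvgrPdist_lt/(_ d d0) := @continuous_atan R r.
apply: filterS => s rs /=.
apply: (le_lt_trans (moment_curve_lipschitz iotaN x_decay fP (g1 r) (g1 s))).
rewrite mulrC -ltr_pdivlMr// ed /g -rmorphB (norm_iota iotaN) (iota_lt iotaN)//.
rewrite -mulrBl normrM [X in _ * X]ger0_norm//.
by apply: le_lt_trans rs; rewrite ler_piMr// invf_le1// ler1n.
Qed.

(** * The real and complex fields *)

Lemma real_normed_real (R : realType) :
  real_normed (idfun : {rmorphism R -> R}).
Proof. by split=> // a; exists `|a|. Qed.

Lemma geometrically_complete_real (R : realType) : geometrically_complete R.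
Proof.
move=> u c uc.
have [l lu] := @geometric_limit _ _ _ (real_normed_real R) R^o u c uc.
exists l => n; apply: (le_trans (lu n)).
have c0 : 0 <= c by have := uc 0; rewrite expr0 divr1; apply: le_trans.
by rewrite ler_wpM2r ?invr_ge0 ?exprn_ge0// ler_wpM2r// ler_nat.
Qed.

Local Open Scope complex_scope.

Lemma real_normed_complex (R : realType) :
  real_normed (real_complex R : {rmorphism R -> R[i]}).
Proof.
split=> [r|a]; last by rewrite normc_def; eexists.
by rewrite normc_def/= expr0n addr0 sqrtr_sqr.
Qed.

Lemma geometrically_complete_complex (R : realType) :
  geometrically_complete R[i].
Proof.
move=> u c uc.
have c0 : 0 <= c by have := uc 0; rewrite expr0 divr1; apply: le_trans.
pose d := complex.Re c.
have cE : c = d%:C by rewrite /d RRe_real// ger0_real.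
have powE (b : R) n : b%:C / 2 ^+ n = (b / 2 ^+ n)%:C.
  by rewrite rmorphM fmorphV rmorphXn rmorph_nat.
have part (p : R[i] -> R) : {morph p : x y / x - y} ->
    (forall z, `|p z|%:C <= `|z|) ->
    exists l, forall n, `|l - p (u n)| <= 2 * d / 2 ^+ n.
  move=> pB pz; apply: (@geometric_limit _ _ _ (real_normed_real R) R^o) => n.
  have := le_trans (pz _) (uc n).
  by rewrite cE powE lecR pB.
have [a ua] := part (@complex.Re R) (raddfB _) (@normc_ge_Re R).
have [b ub] : exists l, forall n, `|l - complex.Im (u n)| <= 2 * d / 2 ^+ n.
  apply: (part _ (raddfB _)) => z.
  by rewrite normc_def lecR -sqrtr_sqr ler_wsqrtr// lerDr sqr_ge0.
exists (a +i* b) => n.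
have -> : a +i* b - u n =
    (a - complex.Re (u n))%:C + 'i * (b - complex.Im (u n))%:C.
  by rewrite [LHS]complexE; case: (u n).
apply: (le_trans (ler_normD _ _)).
rewrite normrM !(norm_iota (real_normed_complex R)) normCi mul1r.
have -> : 4 * c / 2 ^+ n = (2 * d / 2 ^+ n)%:C + (2 * d / 2 ^+ n)%:C.
  by rewrite -!powE !rmorphM rmorph_nat cE; ring.
by apply: lerD; rewrite lecR.
Qed.

Theorem theorem1p1 (R : realType) :
  (forall E : completeNormedModType R,
     ~ finite_dimensional [set: E] ->
     exists P : borel_probability R E, annihilates_finite_dim P) /\
  (forall E : completeNormedModType R[i],
     ~ finite_dimensional [set: E] ->
     exists P : borel_probability R E, annihilates_finite_dim P).
Proof.
split=> E.
  exact: annihilating_probability (real_normed_real R)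
    (@geometrically_complete_real R).
exact: annihilating_probability (real_normed_complex R)
  (@geometrically_complete_complex R).
Qed.
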